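(* Let $f,g$ be non-negative integers. Then in $M^{(f,g)}$, \[\sum_{\mu\in\mathcal P_{f,g}}t_\mu m=\sum_{\lambda\in\mathcal P_{f,g}}F(\lambda)\,s_\lambda m.\]
   Context: $\mathbb F$ is any field, $k=f+g$, $\mathfrak S_k$ has Coxeter generators $t_i=(i\ i{+}1)$ and $s_i=t_i-1\in\mathbb F\mathfrak S_k$. $M^{(f,g)}=\langle m\mid t_im=m\ (i\ne f)\rangle$ as an $\mathbb F\mathfrak S_k$-module. $\mathcal P_{f,g}$ is the set of partitions with at most $g$ nonzero parts, all at most $f$. For $\lambda\in\mathcal P_{f,g}$, $t_\lambda=\prod_{r=1}^{g}(t_{\lambda_r+g-r+1}t_{\lambda_r+g-r+2}\cdots t_{f+g-r})$ with $r=1$ leftmost (a factor is empty if $\lambda_r=f$), and $s_\lambda$ is the same formula with $t_i$ replaced by $s_i$. The function $F$ on partitions is defined recursively: $F(\varnothing)=1$; for $\lambda\ne\varnothing$ choose a node $(a,b)$ of $\lambda$ (i.e. $b\le\lambda_a$) with $a+b$ maximal, and set $F(\lambda)=\binom{a+b}{a}F((\lambda_{a+1},\lambda_{a+2},\dots))\,F((\max\{\lambda_1-b,0\},\max\{\lambda_2-b,0\},\dots))$; this does not depend on the choice of $(a,b)$. The integer $F(\lambda)$ is regarded as an element of $\mathbb F$. *)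

(* Defs.v *)
From mathcomp Require Import all_boot all_order all_algebra all_fingroup.
Set Implicit Arguments. Unset Strict Implicit. Unset Printing Implicit Defensive.
Import GRing.Theory.
Local Open Scope ring_scope.

Definition GA (F : fieldType) (k : nat) := {ffun 'S_k -> F}.

Definition gdelta (F : fieldType) (k : nat) (s : 'S_k) : GA F k :=
  [ffun q => ((q == s) : nat)%:R].

Definition gamul (F : fieldType) (k : nat) (x y : GA F k) : GA F k :=
  [ffun s => \sum_(p : 'S_k) x p * y ((p^-1 * s)%g)].

Definition gascale (F : fieldType) (k : nat) (c : F) (x : GA F k) : GA F k :=
  [ffun s => c * x s].

(* Coxeter generator t_i = (i i+1), 1 <= i < k, in 1-indexed notation;
   on 'I_k (0-indexed) it swaps i-1 and i.  (Default 1 out of range, never used.) *)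
Definition tgen (k i : nat) : 'S_k :=
  match k return 'S_k with
  | 0 => 1%g
  | k'.+1 => if (0 < i < k'.+1)%N then tperm (inord i.-1 : 'I_k'.+1) (inord i) else 1%g
  end.

Definition sgen (F : fieldType) (k i : nat) : GA F k :=
  gdelta F (tgen k i) - gdelta F 1%g.

(* The sequence of indices of the factors of t_lambda (resp. s_lambda):
   for r = 1..g (leftmost first), the indices lambda_r+g-r+1, ..., f+g-r. *)
Definition lam_index (f g : nat) (lam : seq nat) : seq nat :=
  flatten [seq iota (nth 0 lam r.-1 + (g - r) + 1) (f - nth 0 lam r.-1) | r <- iota 1 g].

Definition t_lam (f g : nat) (lam : seq nat) : 'S_(f + g) :=
  foldr (fun j acc => tgen (f + g) j * acc)%g 1%g (lam_index f g lam).

Definition s_lam (F : fieldType) (f g : nat) (lam : seq nat) : GA F (f + g) :=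
  foldr (fun j acc => gamul (sgen F (f + g) j) acc) (gdelta F 1%g) (lam_index f g lam).

(* Elements of P_{f,g}: partitions with at most g parts, all at most f,
   encoded as g-tuples of values in {0..f} which are weakly decreasing
   (trailing zeros pad the partition). *)
Definition is_part (f g : nat) (t : g.-tuple 'I_f.+1) : bool :=
  sorted (fun a b => b <= a)%N (map val t).

(* The function F on partitions (lam a list of parts, possibly with zeros).
   The node (a,b) with a+b maximal lies at the end of some row a, b = lam_a;
   we take the first such row (the value is independent of the choice). *)
Definition node_max (lam : seq nat) : nat :=
  foldr maxn 0%N [seq (if (0 < nth 0 lam i)%N then i.+1 + nth 0 lam i else 0)%N
                 | i <- iota 0 (size lam)].

Definition node_row (lam : seq nat) : nat :=
  find id [seq ((0 < nth 0 lam i)%N && (i.+1 + nth 0 lam i == node_max lam)%N)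
          | i <- iota 0 (size lam)].

Fixpoint Ffuel (n : nat) (lam : seq nat) : nat :=
  match n with
  | 0 => 1
  | n'.+1 =>
    if sumn lam == 0%N then 1%N else
    let a := (node_row lam).+1 in
    let b := nth 0 lam (node_row lam) in
    ('C(a + b, a) * Ffuel n' (drop a lam) * Ffuel n' (map (fun x => x - b) lam))%N
  end.

Definition Fpart (lam : seq nat) : nat := Ffuel (sumn lam).+1 lam.

(* Main.v *)
(* M^(f,g) is the space of words in f zeros and g ones, on which S_k permutes
   positions, with m = 0^f 1^g; the left-hand side is the sum of all words.
   Matching 1 and 0 in a word w as brackets, s_lambda m is the vector C_w obtained
   from w by replacing every matched pair 10 with the antisymmetric 10 - 01.
   Such pairs are killed by the lowering operator E of sl_2, which gives
   E C_w = sum (1 + h z) C_(x0z) over w = x1z with z nonnegative (h = number of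
   1's minus number of 0's).  On the other side, F(1w) = F(w) = F(w0), and
   F(uv) = binom * F(u) F(v) whenever uv is cut at a point of minimal height;
   these imply n_0(w) F(w) = sum (1 + h z) F(x1z) over w = x0z with z nonnegative.
   Hence X = sum F(w) C_w satisfies E X = n_0 X, as does the sum of all words, and
   the two agree by induction on the number of zeros n_0. *)
Require Import Defs.
From mathcomp Require Import all_boot all_order all_algebra all_fingroup.
From mathcomp Require Import zify ring.
Set Implicit Arguments. Unset Strict Implicit. Unset Printing Implicit Defensive.
Import Order.TTheory GRing.Theory Num.Theory.
Local Open Scope nat_scope.

(** * The recursion defining F *)

Lemma nth_gt0_size s i : 0 < nth 0 s i -> i < size s.
Proof. by apply: contraTltn => le_si; rewrite nth_default. Qed.

Lemma sumn_gt0P s : reflect (exists i, 0 < nth 0 s i) (0 < sumn s).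
Proof.
apply: (iffP idP) => [|[i]].
  elim: s => //= -[|x] s IHs; last by exists 0.
  by rewrite add0n => /IHs[i]; exists i.+1.
elim: s i => [|x s IHs] [|i] //=; first by lia.
by move/IHs; lia.
Qed.

Lemma sumn_drop_lt r s : 0 < nth 0 s r -> sumn (drop r.+1 s) < sumn s.
Proof.
move=> pr; rewrite -{2}(cat_take_drop r s) (drop_nth 0 (nth_gt0_size pr)).
by rewrite sumn_cat /=; lia.
Qed.

Lemma sumn_sub b s : sumn [seq x - b | x <- s] <= sumn s.
Proof. by elim: s => //= x s IHs; rewrite leq_add ?leq_subr. Qed.

Lemma sumn_sub_lt r b s : 0 < b -> b <= nth 0 s r ->
  sumn [seq x - b | x <- s] < sumn s.
Proof.
move=> b_gt0; elim: s r => [|x s IHs] [|r] /= le_b; [lia | lia | |].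
  by have := sumn_sub b s; lia.
by have := IHs r le_b; lia.
Qed.

Definition is_node_row (lam : seq nat) (r : nat) : Prop :=
  [/\ 0 < nth 0 lam r,
      forall i, 0 < nth 0 lam i -> i + nth 0 lam i <= r + nth 0 lam r
    & forall i, i < r -> 0 < nth 0 lam i -> i + nth 0 lam i < r + nth 0 lam r].

Lemma is_node_row_uniq lam r r' :
  is_node_row lam r -> is_node_row lam r' -> r = r'.
Proof.
move=> [pr mr lr] [pr' mr' lr']; have := mr _ pr'; have := mr' _ pr.
by case: (ltngtP r r') => // h; [have := lr' _ h pr | have := lr _ h pr']; lia.
Qed.

Definition last_node_sum (lam : seq nat) (i : nat) : nat :=
  if 0 < nth 0 lam i then i.+1 + nth 0 lam i else 0.

Lemma node_maxE lam : node_max lam = \max_(i < size lam) last_node_sum lam i.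
Proof.
rewrite /node_max foldrE big_map -{1}[size lam]subn0.
exact: (big_mkord xpredT).
Qed.

Lemma leq_node_max lam i : 0 < nth 0 lam i -> i.+1 + nth 0 lam i <= node_max lam.
Proof.
move=> pi; rewrite node_maxE.
apply: leq_trans (leq_bigmax (Ordinal (nth_gt0_size pi))).
by rewrite /last_node_sum pi.
Qed.

Lemma node_max_attained lam : 0 < sumn lam ->
  exists2 i, 0 < nth 0 lam i & i.+1 + nth 0 lam i = node_max lam.
Proof.
move=> /sumn_gt0P[j pj]; have := leq_node_max pj; rewrite node_maxE.
have size_gt0 : 0 < #|'I_(size lam)|.
  by rewrite card_ord (leq_ltn_trans _ (nth_gt0_size pj)).
have [i ->] := bigop.eq_bigmax (fun i : 'I_(size lam) => last_node_sum lam i) size_gt0.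
by rewrite /last_node_sum; case: ifP => // pi; exists i.
Qed.

Lemma node_rowP lam : 0 < sumn lam -> is_node_row lam (node_row lam).
Proof.
move=> /node_max_attained[i0 p0 max0].
pose outer i := (0 < nth 0 lam i) && (i.+1 + nth 0 lam i == node_max lam).
have rowE : node_row lam = find outer (iota 0 (size lam)) by rewrite /node_row find_map.
have has_outer : has outer (iota 0 (size lam)).
  by apply/hasP; exists i0; rewrite ?mem_iota ?nth_gt0_size // /outer p0 max0 eqxx.
have row_lt : node_row lam < size lam by rewrite rowE -[X in _ < X](size_iota 0) -has_find.
have := nth_find 0 has_outer; rewrite -rowE nth_iota // => /andP[pr /eqP maxr].
split=> // i => [/leq_node_max|lt_ir pi]; first by rewrite -maxr.
rewrite -ltnS -!addSn maxr ltn_neqAle leq_node_max // andbT.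
have := before_find 0 (etrans (congr1 _ (esym rowE)) lt_ir).
by rewrite nth_iota ?(ltn_trans lt_ir) // /outer pi /= => ->.
Qed.

Lemma node_row_nseq0 lam m : 0 < sumn lam -> node_row (lam ++ nseq m 0) = node_row lam.
Proof.
move=> pos; have [pr mr lr] := node_rowP pos.
have nthE i : nth 0 (lam ++ nseq m 0) i = nth 0 lam i.
  by rewrite nth_cat nth_nseq if_same; case: ltnP => // h; rewrite nth_default.
apply: (@is_node_row_uniq (lam ++ nseq m 0)).
  by apply: node_rowP; rewrite sumn_cat sumn_nseq addn0.
by split=> [|i|i]; rewrite !nthE //; [apply: mr | apply: lr].
Qed.

Lemma Ffuel_nseq0 n lam m : Ffuel n (lam ++ nseq m 0) = Ffuel n lam.
Proof.
elim: n lam m => //= n IHn lam m; rewrite sumn_cat sumn_nseq addn0.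
case: posnP => // pos; have [/nth_gt0_size row_lt _ _] := node_rowP pos.
rewrite node_row_nseq0 // nth_cat row_lt map_cat map_nseq sub0n IHn; congr (_ * _ * _).
rewrite drop_cat; case: ltnP => [_ | le_sz]; first exact: IHn.
by rewrite drop_nseq drop_oversize // -[nseq _ _]cat0s IHn.
Qed.

Lemma Ffuel_enough n m lam : sumn lam < n -> sumn lam < m -> Ffuel n lam = Ffuel m lam.
Proof.
elim: n m lam => // n IHn [//|m] lam lt_n lt_m /=; case: posnP => // pos.
have [pr _ _] := node_rowP pos.
have := sumn_drop_lt pr; have := sumn_sub_lt pr (leqnn _).
(* In [Ffuel] the default entry of [nth] elaborates to the zero of the semiring nat. *)
rewrite -[@GRing.zero _]/0 => lt_sub lt_drop.
by congr (_ * _ * _); apply: IHn; lia.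
Qed.

Lemma Fpart_nseq0 lam m : Fpart (lam ++ nseq m 0) = Fpart lam.
Proof. by rewrite /Fpart Ffuel_nseq0 sumn_cat sumn_nseq addn0. Qed.

Lemma FpartE lam : 0 < sumn lam ->
  let a := (node_row lam).+1 in let b := nth 0 lam (node_row lam) in
  Fpart lam = 'C(a + b, a) * Fpart (drop a lam) * Fpart [seq x - b | x <- lam].
Proof.
move=> pos; have [pr _ _] := node_rowP pos.
rewrite {1}/Fpart /= gtn_eqF //; congr (_ * _ * _); apply: Ffuel_enough => //.
  exact: sumn_drop_lt.
exact: sumn_sub_lt pr (leqnn _).
Qed.

(** * F on words *)

Notation zeros := (count negb).
Notation ones := (count id).

Lemma zeros_ones w : zeros w + ones w = size w.
Proof. by rewrite addnC; apply: count_predC. Qed.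

Lemma zeros0_nseq1 w : zeros w = 0 -> w = nseq (size w) true.
Proof. by elim: w => //= -[] w IHw //= /IHw <-. Qed.

(* A word is read as the boundary of a partition from its bottom left corner:
   false is a step to the right and true a step up, so that the i-th 1 from the
   right (from 0) is row i and its length is the number of 0's before it. *)
Fixpoint part_of_word (w : seq bool) : seq nat :=
  match w with
  | [::] => [::]
  | true :: w' => rcons (part_of_word w') 0
  | false :: w' => map succn (part_of_word w')
  end.

Lemma size_part_of_word w : size (part_of_word w) = ones w.
Proof. by elim: w => //= -[] w IHw; rewrite ?size_rcons ?size_map IHw. Qed.

Lemma part_of_word_cat u v :
  part_of_word (u ++ v) = map (addn (zeros u)) (part_of_word v) ++ part_of_word u.
Proof.
elim: u => [|[] u IHu] /=; first by rewrite cats0 map_id.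
  by rewrite IHu -rcons_cat.
by rewrite IHu map_cat -map_comp.
Qed.

Lemma part_of_word_le_zeros w : all (fun x => x <= zeros w) (part_of_word w).
Proof. by elim: w => //= -[] w IHw /=; rewrite ?all_rcons // all_map. Qed.

Lemma nth_part_of_word u v : nth 0 (part_of_word (u ++ true :: v)) (ones v) = zeros u.
Proof.
rewrite part_of_word_cat nth_cat size_map /= size_rcons size_part_of_word leqnn.
rewrite (nth_map 0) ?size_rcons ?size_part_of_word // nth_rcons.
by rewrite size_part_of_word ltnn eqxx addn0.
Qed.

Lemma nth_one w i : i < ones w -> exists u v, w = u ++ true :: v /\ ones v = i.
Proof.
elim: w i => //= -[] w IHw i /=; last first.
  by rewrite add0n => /IHw[u [v [-> <-]]]; exists (false :: u), v.
rewrite add1n ltnS leq_eqVlt => /orP[/eqP-> | /IHw[u [v [-> <-]]]].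
  by exists [::], w.
by exists (true :: u), v.
Qed.

Definition Fword (w : seq bool) : nat := Fpart (part_of_word w).

Lemma Fword_cons1 w : Fword (true :: w) = Fword w.
Proof. by rewrite /Fword /= -cats1 (Fpart_nseq0 _ 1). Qed.

Lemma Fword_rcons0 w : Fword (rcons w false) = Fword w.
Proof. by rewrite /Fword -cats1 part_of_word_cat. Qed.

Lemma Fword_nseq1 n : Fword (nseq n true) = 1.
Proof. by elim: n => [|n IHn] //; rewrite -[nseq _ _]/(true :: _) Fword_cons1. Qed.

Lemma Fword_node_row u v :
  0 < zeros u -> node_row (part_of_word (u ++ true :: v)) = ones v ->
  Fword (u ++ true :: v) =
    'C(zeros u + (ones v).+1, (ones v).+1) * Fword u * Fword (true :: v).
Proof.
move=> zeros_u row_v; rewrite {1}/Fword FpartE; last first.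
  by apply/sumn_gt0P; exists (ones v); rewrite nth_part_of_word.
rewrite row_v nth_part_of_word addnC part_of_word_cat; congr (_ * Fpart _ * _).
  by rewrite drop_size_cat // size_map size_part_of_word /= add1n.
rewrite map_cat -map_comp (@eq_map _ _ _ id) ?map_id; last by move=> x /=; rewrite addKn.
have -> : [seq x - zeros u | x <- part_of_word u] = nseq (ones u) 0.
  rewrite -size_part_of_word -(size_map (subn^~ (zeros u))).
  apply/all_pred1P; rewrite all_map.
  by apply: sub_all (part_of_word_le_zeros u) => x; rewrite /= subn_eq0.
exact: Fpart_nseq0.
Qed.

Local Open Scope ring_scope.

Definition height (w : seq bool) : int := (ones w)%:Z - (zeros w)%:Z.

Lemma height_cat u v : height (u ++ v) = height u + height v.
Proof. by rewrite /height !count_cat; lia. Qed.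

Lemma height_cons c w : height (c :: w) = (if c then 1 else -1) + height w.
Proof. by case: c; rewrite /height /=; lia. Qed.

Lemma height_rcons w c : height (rcons w c) = height w + (if c then 1 else -1).
Proof. by rewrite -cats1 height_cat height_cons /height /= subrr addr0. Qed.

Lemma height_take_drop i w : height (take i w) + height (drop i w) = height w.
Proof. by rewrite -height_cat cat_take_drop. Qed.

Definition nonneg (z : seq bool) : bool :=
  all (fun i => 0 <= height (take i z)) (iota 0 (size z).+1).

Definition ends_at_min (u : seq bool) : Prop := forall i, height (drop i u) <= 0.

Lemma nonnegP z : reflect (forall i, 0 <= height (take i z)) (nonneg z).
Proof.
apply: (iffP allP) => [pos i | pos i _]; last exact: pos.
case: (leqP i (size z)) => [le_iz | /ltnW/take_oversize ->].
  by apply: pos; rewrite mem_iota.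
by rewrite -[z in height z]take_size pos // mem_iota leqnn.
Qed.

Lemma nonneg_height z : nonneg z -> 0 <= height z.
Proof. by move=> /nonnegP/(_ (size z)); rewrite take_size. Qed.

Lemma nonneg_cat u v : nonneg u -> nonneg v -> nonneg (u ++ v).
Proof.
move=> nu /nonnegP nv; apply/nonnegP => i; rewrite take_cat.
case: ltnP => _; first exact/nonnegP.
by rewrite height_cat addr_ge0 // nonneg_height.
Qed.

Lemma nonneg_cons1 z : nonneg z -> nonneg (true :: z).
Proof. by rewrite -cat1s; apply: nonneg_cat. Qed.

Lemma nonneg_cons0 z : nonneg (false :: z) = false.
Proof. by apply/nonnegP => /(_ 1%N); rewrite /= take0 /height. Qed.

Lemma nonneg_nseq1 n : nonneg (nseq n true).
Proof. by elim: n => // n; apply: nonneg_cons1. Qed.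

Lemma nonneg_prefix u v : nonneg (u ++ v) -> nonneg u.
Proof.
move=> /nonnegP nuv; apply/nonnegP => i; case: (leqP i (size u)) => [le_iu | /ltnW le_ui].
  by have := nuv i; rewrite takel_cat.
by have := nuv (size u); rewrite take_size_cat // take_oversize.
Qed.

Lemma nonneg_suffix u v : height u = 0 -> nonneg (u ++ v) -> nonneg v.
Proof.
move=> hu /nonnegP nuv; apply/nonnegP => i; have := nuv (size u + i)%N.
by rewrite take_cat ltnNge leq_addr addKn height_cat hu add0r.
Qed.

Lemma nonneg_flip p q : nonneg (p ++ false :: q) -> nonneg (p ++ true :: q).
Proof.
move=> /nonnegP n0; apply/nonnegP => i; apply: le_trans (n0 i) _.
rewrite !take_cat; case: ltnP => // _; rewrite !height_cat lerD2l.
by case: (i - size p)%N => // j; rewrite /= !height_cons lerD2r.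
Qed.

Lemma nonneg_insert p q : nonneg (p ++ true :: false :: q) = nonneg (p ++ q).
Proof.
have h10 s : height [:: true, false & s] = height s by rewrite !height_cons; lia.
apply/nonnegP/nonnegP => pos i; rewrite take_cat; case: ltnP => [lt_ip | le_pi].
- by have := pos i; rewrite take_cat lt_ip.
- have := pos i.+2; rewrite take_cat ltnNge !leqW // !subSn ?leqW //=.
  by rewrite !height_cat h10.
- by have := pos i; rewrite take_cat lt_ip.
have np : 0 <= height p by have := pos (size p); rewrite take_size_cat.
case Ej : (i - size p)%N => [|[|j]] /=; rewrite ?cats0 //.
  by rewrite height_cat addr_ge0.
by have := pos (size p + j)%N; rewrite take_cat ltnNge leq_addr addKn !height_cat h10.
Qed.

Lemma ends_at_min_height u : ends_at_min u -> height u <= 0.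
Proof. by move/(_ 0%N); rewrite drop0. Qed.

Lemma ends_at_min_cons c u : ends_at_min (c :: u) <-> height (c :: u) <= 0 /\ ends_at_min u.
Proof.
split=> [eu | [hu eu] [|i]]; [| exact: hu | exact: eu].
by split=> [|i]; [apply: ends_at_min_height | apply: (eu i.+1)].
Qed.

Lemma ends_at_min_rcons0 u : ends_at_min u -> ends_at_min (rcons u false).
Proof.
move=> eu i; case: (leqP i (size u)) => [le_iu | lt_ui].
  by rewrite drop_rcons // height_rcons; have := eu i; lia.
by rewrite drop_oversize // size_rcons.
Qed.

Lemma ends_at_min_zeros_gt0 u : u != [::] -> ends_at_min u -> (0 < zeros u)%N.
Proof.
move=> u_nil /ends_at_min_height; rewrite /height.
by rewrite -size_eq0 -zeros_ones in u_nil; lia.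
Qed.

Lemma nonneg_ends_at_min u : height u = 0 -> nonneg u <-> ends_at_min u.
Proof.
move=> hu; split=> [/nonnegP nu i | eu]; last apply/nonnegP => i.
  by have := height_take_drop i u; have := nu i; lia.
by have := height_take_drop i u; have := eu i; lia.
Qed.

Lemma mul_bin_assoc n m p :
  ('C(n + m + p, p) * 'C(n + m, m) = 'C(n + (m + p), m + p) * 'C(m + p, p))%N.
Proof.
have binDr a b : ('C(a + b, b) * (b`! * a`!) = (a + b)`!)%N.
  by rewrite -[in RHS](@bin_fact _ b) ?leq_addl // addnK.
have := binDr (n + m)%N p; have := binDr n (m + p)%N; rewrite !addnA => E1 E2.
have fact_gt0s : (0 < n`! * m`! * p`!)%N by rewrite !muln_gt0 !fact_gt0.
apply/eqP; rewrite -(eqn_pmul2r fact_gt0s); apply/eqP; transitivity ((n + m + p)`!).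
  by rewrite -E2 -(binDr n m); ring.
by rewrite -E1 -(binDr m p); ring.
Qed.

(* The node chosen by F sits at the last point of minimal height that is followed
   by a 1; it cannot lie in [u] because [u] ends at a point of minimal height. *)
Lemma Fword_last_minimum u v : (0 < zeros u)%N -> ends_at_min u -> nonneg (true :: v) ->
  exists q s, [/\ true :: v = q ++ true :: s, height q = 0 &
    Fword (u ++ true :: v) =
      ('C(zeros (u ++ q) + (ones s).+1, (ones s).+1)
        * Fword (u ++ q) * Fword (true :: s))%N].
Proof.
move=> zeros_u eu nv; set w := u ++ true :: v; set r := node_row (part_of_word w).
have nth_v : nth 0%N (part_of_word w) (ones v) = zeros u by apply: nth_part_of_word.
have [|pr max_r min_r] := @node_rowP (part_of_word w).
  by apply/sumn_gt0P; exists (ones v); rewrite nth_v.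
have := nth_gt0_size pr; rewrite -/r size_part_of_word count_cat => lt_r.
case: (ltnP r (ones (true :: v))) => [/nth_one[q [s [Ev Es]]] | le_vr].
  have nth_r : nth 0%N (part_of_word w) r = zeros (u ++ q).
    by rewrite /w Ev catA -Es nth_part_of_word.
  exists q, s; split=> //; last first.
    rewrite /w Ev catA Fword_node_row ?count_cat ?addn_gt0 ?zeros_u //.
    by rewrite -catA -Ev -/w -/r Es.
  have := max_r (ones v); rewrite nth_v -/r nth_r -Es count_cat => /(_ zeros_u).
  have := nonneg_height (nonneg_prefix (etrans (congr1 _ (esym Ev)) nv)).
  by move: (congr1 (fun w => ones w) Ev); rewrite /height count_cat /=; lia.
have [|t [s [Eu Es]]] := @nth_one u (r - ones (true :: v)); first by lia.
have := eu (size t); rewrite Eu drop_size_cat // height_cons.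
have := min_r (ones v); rewrite -/r nth_v => /(_ _ zeros_u).
have -> : nth 0%N (part_of_word w) r = zeros t.
  rewrite -(nth_part_of_word t (s ++ true :: v)) /w Eu -catA count_cat Es.
  by congr (nth _ _ _); lia.
rewrite /height Eu !count_cat /=; rewrite /= in le_vr Es; lia.
Qed.

Lemma Fword_cat u v : ends_at_min u -> nonneg v ->
  Fword (u ++ v) = ('C(zeros u + ones v, ones v) * Fword u * Fword v)%N.
Proof.
have [n] := ubnP (size (u ++ v)); elim: n u v => // n IHn u v /ltnSE-le_n eu nv.
have [-> | u_nil] := eqVneq u [::]; first by rewrite binn !mul1n.
case: v le_n nv => [|[] v] le_n nv; last by rewrite nonneg_cons0 in nv.
  by rewrite cats0 bin0 muln1 mul1n.
have zeros_u := ends_at_min_zeros_gt0 u_nil eu.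
have [q [s [Ev hq ->]]] := Fword_last_minimum zeros_u eu nv.
have nq : nonneg q by apply: (@nonneg_prefix _ (true :: s)); rewrite -Ev.
have ns : nonneg (true :: s) by apply: (@nonneg_suffix q); rewrite -?Ev.
have eq : ends_at_min q by apply/nonneg_ends_at_min.
move: le_n; rewrite Ev !size_cat /= => le_n.
have size_u : (0 < size u)%N by rewrite lt0n size_eq0.
rewrite (IHn u q) ?(IHn q (true :: s)) ?size_cat //=; [| lia | lia].
have ones_q : ones q = zeros q by move: hq; rewrite /height; lia.
rewrite !count_cat /= -ones_q add1n.
have := mul_bin_assoc (zeros u) (ones q) (ones s).+1.
by move=> /(congr1 (muln (Fword u * Fword q * Fword (true :: s)))); lia.
Qed.

Lemma nonneg_or_min_split w :
  nonneg w \/ exists u v, [/\ w = u ++ false :: v, ends_at_min u & nonneg v].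
Proof.
elim: w => [|c w [nw | [u [v [-> eu nv]]]]]; first by left.
  by case: c; [left; apply: nonneg_cons1 | right; exists [::], w].
have [hcu | hcu] := lerP (height (c :: u)) 0.
  by right; exists (c :: u), v; split=> //; apply/ends_at_min_cons.
have := ends_at_min_height eu; rewrite height_cons in hcu.
case: c hcu => hcu hu; [left | lia].
have hu0 : height (true :: rcons u false) = 0.
  by rewrite height_cons height_rcons; lia.
rewrite -cat_rcons -cat_cons; apply: nonneg_cat nv; apply/nonneg_ends_at_min => //.
by apply/ends_at_min_cons; rewrite hu0; split=> //; apply: ends_at_min_rcons0.
Qed.

(** * Flip sums *)

Section FlipSum.
Variable R : comPzRingType.
Implicit Types (b : bool) (wt phi psi : seq bool -> R) (u v w : seq bool) (a : R).

(* The sum of [wt z * phi (x ++ ~~ b :: z)] over the factorisations [w = x ++ b :: z]. *)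
Fixpoint flip_sum b wt phi w : R :=
  if w is c :: w' then
    (if c == b then wt w' * phi (~~ b :: w') else 0)
      + flip_sum b wt (fun x => phi (c :: x)) w'
  else 0.

Lemma eq_flip_sum b wt wt' phi psi w :
    (forall p q, w = p ++ b :: q ->
      wt q * phi (p ++ ~~ b :: q) = wt' q * psi (p ++ ~~ b :: q)) ->
  flip_sum b wt phi w = flip_sum b wt' psi w.
Proof.
elim: w phi psi => //= c w IHw phi psi eq_phi; congr (_ + _).
  by case: eqP => // Ec; apply: (eq_phi [::]); rewrite Ec.
by apply: IHw => p q Ew; apply: (eq_phi (c :: p)); rewrite Ew.
Qed.

Lemma flip_sum0 b wt w : flip_sum b wt (fun=> 0) w = 0.
Proof. by elim: w => //= c w ->; rewrite mulr0 if_same addr0. Qed.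

Lemma flip_sumZ b wt a phi w :
  flip_sum b wt (fun x => a * phi x) w = a * flip_sum b wt phi w.
Proof.
elim: w phi => [|c w IHw] phi /=; first by rewrite mulr0.
by rewrite IHw mulrDr mulrCA; case: eqP; rewrite ?mulr0.
Qed.

Lemma flip_sum_sum b wt (I : finType) (phi : I -> seq bool -> R) w :
  flip_sum b wt (fun x => \sum_i phi i x) w = \sum_i flip_sum b wt (phi i) w.
Proof.
elim: w phi => [|c w IHw] phi /=; first by rewrite big1.
rewrite IHw big_split /=; case: eqP => _; first by rewrite mulr_sumr.
by rewrite [X in _ = X + _]big1.
Qed.

Lemma flip_sum_cat b wt phi u v :
  flip_sum b wt phi (u ++ v) =
    flip_sum b (fun z => wt (z ++ v)) (fun x => phi (x ++ v)) u
      + flip_sum b wt (fun x => phi (u ++ x)) v.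
Proof. by elim: u phi => [|c u IHu] phi /=; rewrite ?add0r // IHu addrA. Qed.

Lemma flip_sum_zeros a w : flip_sum false (fun=> 1) (fun=> a) w = (zeros w)%:R * a.
Proof.
elim: w => [|c w IHw] /=; first by rewrite mul0r.
by rewrite IHw natrD mulrDl; case: c; rewrite /= !(mul0r, mul1r).
Qed.
End FlipSum.

Definition flip_weight (z : seq bool) : int := if nonneg z then 1 + height z else 0.

Notation weighted_flip_sum b := (flip_sum b flip_weight).

(* The lowering operator of sl_2, on functions of words. *)
Notation lowering := (flip_sum false (fun=> 1)).

Lemma flip_weight_cons0 z : flip_weight (false :: z) = 0.
Proof. by rewrite /flip_weight nonneg_cons0. Qed.

Lemma flip_weight_insert p q :
  flip_weight (p ++ true :: false :: q) = flip_weight (p ++ q).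
Proof.
rewrite /flip_weight nonneg_insert; congr (if _ then 1 + _ else _).
by rewrite !height_cat !height_cons; lia.
Qed.

Lemma weighted_flip_sum_ends_at_min phi u v : ends_at_min u ->
  weighted_flip_sum false phi (u ++ false :: v) =
  weighted_flip_sum false (fun x => phi (u ++ x)) (false :: v).
Proof.
move=> eu; rewrite flip_sum_cat [X in X + _](_ : _ = 0) ?add0r //.
rewrite -[RHS](flip_sum0 false flip_weight u).
apply: eq_flip_sum => p q Eu; rewrite mulr0 /flip_weight -cat_rcons.
case: ifP => [/nonneg_prefix/nonneg_height | _]; last by rewrite mul0r.
have := eu (size p).+1; rewrite Eu -cat_rcons drop_size_cat ?size_rcons //.
by rewrite height_rcons; lia.
Qed.

Lemma bin_weighted_sum (a b c : nat) :
  (1 + b%:Z - c%:Z) * 'C(a + b.+1, b.+1)%:Z + c%:Z * 'C(a.+1 + b.+1, b.+1)%:Z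
  = (a.+1 + c)%:Z * 'C(a.+1 + b, b)%:Z.
Proof.
have pascal : 'C(a.+1 + b.+1, b.+1) = ('C(a.+1 + b, b.+1) + 'C(a.+1 + b, b))%N.
  by rewrite addnS binS.
have := mul_bin_left (a.+1 + b) b; rewrite addnK pascal -addSnnS.
by move: ('C(_, b)) ('C(_, b.+1)) => A B; lia.
Qed.

Lemma weighted_flip_sum_Fword w :
  weighted_flip_sum false (fun x => (Fword x)%:Z) w = (zeros w)%:Z * (Fword w)%:Z.
Proof.
have [n] := ubnP (size w); elim: n w => // n IHn w /ltnSE-le_n.
have [|[u [v [Ew eu nv]]]] := nonneg_or_min_split w.
  case: w le_n => [|[] w] //= le_n; last by rewrite nonneg_cons0.
  move=> _; rewrite !add0r Fword_cons1 -IHn //.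
  by apply: eq_flip_sum => p q _; rewrite Fword_cons1.
have eu0 := ends_at_min_rcons0 eu.
rewrite Ew weighted_flip_sum_ends_at_min //= /flip_weight nv -/flip_weight.
have -> : weighted_flip_sum false (fun x => (Fword (u ++ false :: x))%:Z) v =
    ('C((zeros u).+1 + (ones v).+1, (ones v).+1) * Fword u)%:Z
      * ((zeros v)%:Z * (Fword v)%:Z).
  rewrite -IHn -?flip_sumZ; last by move: le_n; rewrite Ew size_cat /=; lia.
  apply: eq_flip_sum => p q Ev; congr (_ * _).
  rewrite -cat_rcons Fword_cat //; last by apply: nonneg_flip; rewrite -Ev.
  rewrite Fword_rcons0 -cats1 Ev !count_cat /= -PoszM.
  by congr (Posz ('C(_, _) * _ * _)); lia.
rewrite -[u ++ false :: v]cat_rcons !Fword_cat ?nonneg_cons1 // Fword_rcons0 Fword_cons1.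
rewrite -cats1 !count_cat /= !addn0 add1n addn1 !PoszM.
have := bin_weighted_sum (zeros u) (ones v) (zeros v).
by move=> /(congr1 ( *%R ((Fword u)%:Z * (Fword v)%:Z))); rewrite /height; lia.
Qed.

(** * Cup vectors *)

Definition antisym (d c : bool) : int := if d == c then 0 else if d then 1 else -1.

(* The coefficient of the word v in the vector obtained from w by replacing each
   matched pair 1...0 with 10 - 01; st holds the letters of v facing the pending 1's. *)
Fixpoint cup_coef (st w v : seq bool) : int :=
  match w, v with
  | [::], [::] => (all id st)%:R
  | true :: w', c :: v' => cup_coef (c :: st) w' v'
  | false :: w', c :: v' =>
      if st is d :: st' then antisym d c * cup_coef st' w' v'
      else if c then 0 else cup_coef [::] w' v'
  | _, _ => 0
  end.

Definition cup_vec := cup_coef [::].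

Lemma cup_coef_insert st p q v1 v2 c d : size v1 = size p ->
  cup_coef st (p ++ true :: false :: q) (v1 ++ c :: d :: v2) =
  antisym c d * cup_coef st (p ++ q) (v1 ++ v2).
Proof.
elim: p v1 st => [|[] p IHp] [|b v1] st //= [sz]; first exact: IHp.
case: st => [|a st]; last by rewrite IHp // mulrCA.
by case: b; rewrite ?mulr0 // IHp.
Qed.

Lemma cup_coef_rcons1 st w v : cup_coef (rcons st true) w v = cup_coef st w v.
Proof.
elim: w v st => [|[] w IHw] [|c v] st //=.
- by rewrite all_rcons.
- by rewrite -rcons_cons IHw.
case: st => [|a st] /=; last by rewrite IHw.
by case: c; rewrite /antisym /= ?mul0r ?mul1r.
Qed.

Lemma cup_coef_rcons0 st w v : (zeros w <= size st)%N -> cup_coef (rcons st false) w v = 0.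
Proof.
elim: w v st => [|[] w IHw] [|c v] st //=.
- by rewrite all_rcons.
- by move=> le_st; rewrite -rcons_cons IHw //= ltnW.
by case: st => [|a st] //= le_st; rewrite IHw ?mulr0.
Qed.

Lemma cup_coef_swap st x y v1 v2 c d : size v1 = size x ->
  cup_coef st (x ++ false :: true :: y) (v1 ++ d :: c :: v2)
  - cup_coef st (x ++ false :: true :: y) (v1 ++ c :: d :: v2)
  = cup_coef st (x ++ true :: false :: y) (v1 ++ c :: d :: v2).
Proof.
elim: x v1 st => [|[] x IHx] [|b v1] st //=.
- case: st => [|a st] _.
    have /= bottom1 := cup_coef_rcons1 [::].
    by case: c; case: d; rewrite ?bottom1 /antisym /=; ring.
  by case: a; case: c; case: d; rewrite /antisym /=; ring.
- by case=> sz; apply: IHx.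
case=> sz; case: st => [|a st]; last by rewrite -mulrBr IHx.
by case: b; [rewrite subr0 | apply: IHx].
Qed.

Lemma cup_coef_zeros st w v : cup_coef st w v != 0 -> (zeros st + zeros v = zeros w)%N.
Proof.
elim: w v st => [|[] w IHw] [|c v] st //=; rewrite ?eqxx //.
- rewrite addn0; case: (boolP (all id st)) => // + _.
  by elim: st => //= -[].
- by move/IHw => /=; lia.
case: st => [|a st] /=.
  by case: c; rewrite ?eqxx // => /IHw /=; lia.
by rewrite mulf_eq0 negb_or => /andP[+ /IHw]; case: a; case: c; rewrite /antisym /=; lia.
Qed.

Lemma cup_vec_zeros_neq w v : zeros v != zeros w -> cup_vec w v = 0.
Proof. by apply: contraNeq => /cup_coef_zeros/eqP. Qed.

Lemma cup_coef_nseq1 st n v : size v = n ->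
  cup_coef st (nseq n true) v = (all id v && all id st)%:R.
Proof.
elim: n v st => [|n IHn] [|c v] st //= [sz].
by rewrite IHn //= andbA [c && _]andbC.
Qed.

Lemma cup_vec_nseq n m v : size v = (n + m)%N ->
  cup_vec (nseq n false ++ nseq m true) v = (v == nseq n false ++ nseq m true)%:R.
Proof.
elim: n v => [|n IHn] v /= sz.
  rewrite /cup_vec cup_coef_nseq1 // andbT -[X in nseq X]sz; congr (nat_of_bool _)%:R.
  by elim: v {sz} => //= -[] v IHv; rewrite eqseq_cons //= IHv.
by case: v sz => // -[] v [sz] //=; rewrite /cup_vec /= -/cup_vec IHn // eqseq_cons.
Qed.

Lemma bracket_ind (P : seq bool -> Prop) :
    (forall n, P (nseq n true)) -> (forall w, P w -> P (false :: w)) ->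
    (forall p q, P (p ++ q) -> P (p ++ true :: false :: q)) ->
  forall w, P w.
Proof.
move=> P_ones P_cons0 P_insert w.
have [n] := ubnP (size w); elim: n w => // n IHn w /ltnSE-le_n.
have : [\/ exists m, w = nseq m true, exists w', w = false :: w'
         | exists p q, w = p ++ true :: false :: q].
  elim: w {le_n} => [|[] w IHw].
  - by constructor 1; exists 0%N.
  - case: IHw => [[m ->]|[w' ->]|[p [q ->]]].
    + by constructor 1; exists m.+1.
    + by constructor 3; exists [::], w'.
    by constructor 3; exists (true :: p), q.
  by constructor 2; exists w.
case=> [[m ->] //|[w' Ew]|[p [q Ew]]]; rewrite Ew in le_n *.
  by apply/P_cons0/IHn.
by apply/P_insert/IHn; move: le_n; rewrite !size_cat /=; lia.
Qed.

Lemma split_pair (T : Type) (s : seq T) n m : size s = (n + m.+2)%N ->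
  exists s1 x y s2, [/\ s = s1 ++ x :: y :: s2, size s1 = n & size s2 = m].
Proof.
elim: n s => [|n IHn] [|x s] //= [].
  by case: s => //= y s [<-]; exists [::], x, y, s.
by move=> /IHn[s1 [y [z [s2 [-> <- <-]]]]]; exists (x :: s1), y, z, s2.
Qed.

Lemma flip_weight_nseq1 n : flip_weight (nseq n true) = n.+1%:Z.
Proof. by rewrite /flip_weight nonneg_nseq1 /height !count_nseq /= mul1n mul0n; lia. Qed.

Lemma weighted_flip_sum_pending0 n v : size v = n ->
  weighted_flip_sum true (fun x => cup_coef [:: false] x v) (nseq n true) =
  - (n%:Z * (all id v)%:R).
Proof.
case: n v => [|n] [|c v] // [sz] /=.
rewrite flip_weight_nseq1 cup_coef_nseq1 // (@eq_flip_sum _ _ _ flip_weight _ (fun=> 0)).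
  by rewrite flip_sum0; case: c; rewrite /antisym /= ?andbT; lia.
move=> p q En; congr (_ * _); apply: (@cup_coef_rcons0 [:: c]).
by have := congr1 (fun s => zeros s) En; rewrite count_nseq !count_cat /=; lia.
Qed.

Lemma lowering_cup_vec_nseq1 n v : size v = n ->
  lowering (cup_vec (nseq n true)) v =
  weighted_flip_sum true (cup_vec^~ v) (nseq n true).
Proof.
elim: n v => [|n IHn] [|c v] //= [sz].
have size_flip p q : v = p ++ false :: q -> size (p ++ true :: q) = n.
  by move=> Ev; rewrite -sz Ev !size_cat.
rewrite flip_weight_nseq1 /cup_vec /= !cup_coef_nseq1 //= mul1r.
case: c; last first.
  rewrite weighted_flip_sum_pending0 // andbT (@eq_flip_sum _ _ _ (fun=> 1) _ (fun=> 0)).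
    by rewrite flip_sum0 /=; ring.
  by move=> p q /size_flip sz'; rewrite cup_coef_nseq1 // andbF.
rewrite mulr0 !add0r (@eq_flip_sum _ true _ flip_weight _ (cup_vec^~ v)); last first.
  by move=> p q _; rewrite (cup_coef_rcons1 [::]).
rewrite -IHn //; apply: eq_flip_sum => p q /size_flip sz'.
by rewrite /cup_vec !cup_coef_nseq1 //= andbT.
Qed.

(* The vector 10 - 01 is killed by lowering and 10 has the weight of the empty word,
   so both sides only see what is left after removing the pair. *)
Lemma lowering_cup_vec_insert p q v :
    (forall v', size v' = size (p ++ q) ->
      lowering (cup_vec (p ++ q)) v' =
      weighted_flip_sum true (cup_vec^~ v') (p ++ q)) ->
    size v = size (p ++ true :: false :: q) ->
  lowering (cup_vec (p ++ true :: false :: q)) v =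
  weighted_flip_sum true (cup_vec^~ v) (p ++ true :: false :: q).
Proof.
move=> IHpq; rewrite size_cat => /split_pair[v1 [c [d [v2 [-> sz1 sz2]]]]].
transitivity (antisym c d * lowering (cup_vec (p ++ q)) (v1 ++ v2)).
  rewrite !flip_sum_cat /= mulrDr -!flip_sumZ !mul1r; congr (_ + _).
    apply: eq_flip_sum => a b Ev1.
    by rewrite /cup_vec cup_coef_insert // -sz1 Ev1 !size_cat.
  rewrite addrA -[RHS]add0r; congr (_ + _).
    by rewrite /cup_vec !cup_coef_insert //; case: c; case: d; rewrite /antisym /=; ring.
  by apply: eq_flip_sum => a b _; rewrite /cup_vec cup_coef_insert.
rewrite IHpq ?size_cat ?sz1 ?sz2 // !flip_sum_cat mulrDr -!flip_sumZ /=.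
rewrite flip_weight_cons0 mul0r !add0r; congr (_ + _).
  apply: eq_flip_sum => a b Ep; rewrite flip_weight_insert.
  by rewrite /cup_vec cup_coef_insert // sz1 Ep !size_cat.
by apply: eq_flip_sum => a b _; rewrite /cup_vec cup_coef_insert.
Qed.

Lemma lowering_cup_vec w v : size v = size w ->
  lowering (cup_vec w) v = weighted_flip_sum true (cup_vec^~ v) w.
Proof.
elim/bracket_ind: w v => [n v | w IHw [|c v] //= [sz] | p q IHpq v].
- by rewrite size_nseq; apply: lowering_cup_vec_nseq1.
- rewrite add0r; case: c; last by rewrite /cup_vec /= mulr0 add0r; apply: IHw.
  by rewrite /cup_vec /= !flip_sum0 addr0.
exact: lowering_cup_vec_insert.
Qed.

Lemma sum_cons_tuple (V : nmodType) (T : finType) k (Phi : seq T -> V) :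
  \sum_(w : k.+1.-tuple T) Phi w = \sum_(w : k.-tuple T) \sum_(x : T) Phi (x :: w).
Proof.
rewrite pair_bigA /= (reindex (fun p : k.-tuple T * T => [tuple of p.2 :: p.1])) //.
exists (fun w : k.+1.-tuple T => ([tuple of behead w], thead w)) => [[w x] _ | w _] /=.
  by rewrite theadE; congr (_, _); apply: val_inj.
by rewrite -tuple_eta.
Qed.

Lemma flip_sum_adjoint (R : comPzRingType) k b (wt psi phi : seq bool -> R) :
  \sum_(w : k.-tuple bool) psi w * flip_sum b wt phi w =
  \sum_(w : k.-tuple bool) flip_sum (~~ b) wt psi w * phi w.
Proof.
elim: k psi phi => [|k IHk] psi phi.
  by rewrite !big1 // => w _; rewrite tuple0 /= ?mulr0 ?mul0r.
rewrite (sum_cons_tuple _ (fun w => psi w * flip_sum b wt phi w)).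
rewrite (sum_cons_tuple _ (fun w => flip_sum (~~ b) wt psi w * phi w)).
pose swapped (w : k.-tuple bool) := wt w * psi (b :: w) * phi (~~ b :: w).
transitivity (\sum_w swapped w +
    \sum_(x : bool) \sum_(w : k.-tuple bool)
       psi (x :: w) * flip_sum b wt (fun y => phi (x :: y)) w).
  rewrite [X in _ = _ + X]exchange_big -big_split; apply: eq_bigr => w _.
  by rewrite !big_bool /swapped; case: (b) => /=; ring.
under [X in _ + X]eq_bigr => x _ do rewrite (IHk (fun w => psi (x :: w))) /=.
rewrite [X in _ + X]exchange_big -big_split; apply: eq_bigr => w _.
by rewrite !big_bool /swapped; case: (b) => /=; ring.
Qed.

Lemma sum_Fword_cup_vec_nseq1 k :
  \sum_(w : k.-tuple bool) (Fword w)%:Z * cup_vec w (nseq k true) = 1.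
Proof.
rewrite (bigD1 [tuple of nseq k true]) //= big1 ?addr0 => [|w].
  by rewrite Fword_nseq1 /cup_vec cup_coef_nseq1 ?size_nseq // andbT all_nseq orbT.
rewrite -val_eqE /= => w_ones; rewrite cup_vec_zeros_neq ?mulr0 //.
rewrite count_nseq mul0n; apply: contra_neq w_ones => /esym/zeros0_nseq1.
by rewrite size_tuple.
Qed.

(* Lowering multiplies both sides by [zeros v] and only involves their values at the
   words with one 0 fewer. *)
Lemma sum_Fword_cup_vec k v : size v = k ->
  \sum_(w : k.-tuple bool) (Fword w)%:Z * cup_vec w v = 1.
Proof.
have [n] := ubnP (zeros v); elim: n v => // n IHn v /ltnSE-le_n sz.
have [/zeros0_nseq1 -> | zeros_v] := posnP (zeros v).
  by rewrite sz sum_Fword_cup_vec_nseq1.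
apply: (@mulfI _ (zeros v)%:Z); first by rewrite -lt0n in zeros_v *; lia.
pose total x := \sum_(w : k.-tuple bool) (Fword w)%:Z * cup_vec w x.
transitivity (lowering total v); last first.
  rewrite -[in RHS]natz -flip_sum_zeros; apply: eq_flip_sum => p q Ev.
  congr (_ * _); apply: IHn; last by rewrite -sz Ev !size_cat.
  by move: le_n; rewrite Ev !count_cat /=; lia.
rewrite flip_sum_sum.
under [RHS]eq_bigr => w _ do rewrite flip_sumZ lowering_cup_vec ?sz ?size_tuple //.
rewrite (flip_sum_adjoint _ _ _ (fun w => (Fword w)%:Z)) mulr_sumr; apply: eq_bigr => w _.
rewrite weighted_flip_sum_Fword; have [-> | neq] := eqVneq (zeros v) (zeros w).
  by rewrite mulrA.
by rewrite cup_vec_zeros_neq ?mulr0.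
Qed.

Lemma sum_Fword_cup_vec_zeros k n (v : k.-tuple bool) :
  \sum_(w : k.-tuple bool | zeros w == n) (Fword w)%:Z * cup_vec w v = (zeros v == n)%:R.
Proof.
have [<- | zeros_v] := eqVneq (zeros v) n.
  rewrite -(sum_Fword_cup_vec (size_tuple v)).
  rewrite [RHS](bigID (fun w : k.-tuple _ => zeros w == zeros v)) /=.
  rewrite [X in _ = _ + X]big1 ?addr0 // => w; rewrite eq_sym => zeros_w.
  by rewrite cup_vec_zeros_neq ?mulr0.
rewrite big1 // => w /eqP zeros_w.
by rewrite cup_vec_zeros_neq ?mulr0 // zeros_w.
Qed.

Lemma sum_eq_word (R : pzSemiRingType) k n (v : k.-tuple bool) :
  \sum_(w : k.-tuple bool | zeros w == n) (w == v :> seq bool)%:R = (zeros v == n)%:R :> R.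
Proof.
rewrite big_mkcond (bigD1 v) //= big1 => [|w /negPf ne_wv]; last first.
  by rewrite val_eqE ne_wv if_same.
by rewrite eqxx addr0; case: ifP.
Qed.

(** * Words and partitions *)

Fixpoint word_of_part (f : nat) (l : seq nat) : seq bool :=
  if l is x :: l' then word_of_part x l' ++ true :: nseq (f - x) false else nseq f false.

Lemma geq_trans : transitive geq.
Proof. by move=> n m p le_nm le_pn; apply: leq_trans le_pn le_nm. Qed.

Lemma word_of_part_widen x f l : (x <= f)%N -> path geq x l ->
  word_of_part f l = word_of_part x l ++ nseq (f - x) false.
Proof.
case: l => [|y l] le_xf /=; first by rewrite -nseqD subnKC.
by case/andP=> le_yx _; rewrite -catA /= -nseqD; congr (_ ++ _ :: nseq _ _); lia.
Qed.

Lemma ones_word_of_part f l : ones (word_of_part f l) = size l.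
Proof.
elim: l f => [|x l IHl] f /=; first by rewrite count_nseq mul0n.
by rewrite count_cat IHl /= count_nseq mul0n addn0 addn1.
Qed.

Lemma zeros_word_of_part f l : path geq f l -> zeros (word_of_part f l) = f.
Proof.
elim: l f => [|x l IHl] f /=; first by rewrite count_nseq mul1n.
by case/andP=> le_xf /IHl zeros_l; rewrite count_cat zeros_l /= count_nseq mul1n subnKC.
Qed.

Lemma size_word_of_part f l : path geq f l -> size (word_of_part f l) = (f + size l)%N.
Proof. by move=> path_l; rewrite -zeros_ones zeros_word_of_part // ones_word_of_part. Qed.

Lemma part_of_word_nseq0 n : part_of_word (nseq n false) = [::].
Proof. by elim: n => //= n ->. Qed.

Lemma word_of_partK f l : path geq f l -> part_of_word (word_of_part f l) = l.
Proof.
elim: l f => [|x l IHl] f /=; first by rewrite part_of_word_nseq0.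
case/andP=> le_xf path_l.
by rewrite part_of_word_cat /= part_of_word_nseq0 /= addn0 zeros_word_of_part // IHl.
Qed.

Lemma word_of_part_rcons0 f l : word_of_part f (rcons l 0%N) = true :: word_of_part f l.
Proof. by elim: l f => [|x l IHl] f /=; rewrite ?subn0 // IHl. Qed.

Lemma word_of_part_succ f l : word_of_part f.+1 (map succn l) = false :: word_of_part f l.
Proof. by elim: l f => [|x l IHl] f //=; rewrite IHl subSS. Qed.

Lemma part_of_wordK w : word_of_part (zeros w) (part_of_word w) = w.
Proof.
by elim: w => [|[] w IHw] //=; rewrite ?add1n ?word_of_part_rcons0 ?word_of_part_succ IHw.
Qed.

Lemma path_part_of_word w : path geq (zeros w) (part_of_word w).
Proof.
elim: w => [|[] w IHw] //=; first by rewrite rcons_path IHw.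
by rewrite add1n path_map.
Qed.

Lemma is_partE f g (t : g.-tuple 'I_f.+1) : is_part t = path geq f (map val t).
Proof.
by rewrite /is_part; case: (tval t) => [|x s] //=; rewrite -ltnS ltn_ord.
Qed.

Lemma sum_word_of_part (V : nmodType) f g (Phi : seq bool -> V) :
  \sum_(t : g.-tuple 'I_f.+1 | is_part t) Phi (word_of_part f (map val t)) =
  \sum_(w : (f + g).-tuple bool | zeros w == f) Phi w.
Proof.
pose part_tuple (w : (f + g).-tuple bool) : g.-tuple 'I_f.+1 :=
  insubd [tuple of nseq g ord0] [seq inord x | x <- part_of_word w].
pose word_tuple (t : g.-tuple 'I_f.+1) : (f + g).-tuple bool :=
  insubd [tuple of nseq (f + g) false] (word_of_part f (map val t)).
have word_tupleE t : is_part t -> word_tuple t = word_of_part f (map val t) :> seq bool.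
  rewrite is_partE => path_t; rewrite val_insubd ifT //.
  by rewrite size_word_of_part // size_map size_tuple.
have part_tupleE (w : (f + g).-tuple bool) : zeros w = f ->
    map val (part_tuple w) = part_of_word w.
  move=> zeros_w; rewrite val_insubd ifT; last first.
    by rewrite size_map size_part_of_word -(eqn_add2l f) -{1}zeros_w zeros_ones size_tuple.
  rewrite -map_comp -[RHS]map_id; apply/eq_in_map => x /(allP (part_of_word_le_zeros w)).
  by rewrite zeros_w => le_xf; rewrite /= inordK.
rewrite (reindex_onto part_tuple word_tuple) => [|t pt]; last first.
  apply/val_inj/(inj_map val_inj); rewrite part_tupleE word_tupleE //.
    by rewrite word_of_partK // -is_partE.
  by rewrite zeros_word_of_part // -is_partE.
have word_tupleK (w : (f + g).-tuple bool) : zeros w = f ->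
    is_part (part_tuple w) /\ word_tuple (part_tuple w) = w.
  move=> zeros_w; have part_w : is_part (part_tuple w).
    by rewrite is_partE part_tupleE // -[X in path _ X]zeros_w path_part_of_word.
  split=> //; apply: val_inj; rewrite /= word_tupleE // part_tupleE //.
  by rewrite -[X in word_of_part X]zeros_w part_of_wordK.
apply: eq_big => [w | w /andP[part_w /eqP {2}<-]]; last by rewrite word_tupleE.
apply/andP/eqP => [[part_w /eqP <-] | /word_tupleK[-> ->]] //.
by rewrite word_tupleE // zeros_word_of_part // -is_partE.
Qed.

Lemma lam_index_cons f g x l : lam_index f g.+1 (x :: l) =
  iota (x + g).+1 (f - x) ++ lam_index f g l.
Proof.
rewrite /lam_index /= subSS subn0 addn1; congr (_ ++ flatten _).
rewrite (iotaDl 1 1) -map_comp; apply/eq_in_map => r.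
by rewrite mem_iota /= => /andP[r_gt0 _]; rewrite subSS; case: r r_gt0.
Qed.

(** * The module M^(f,g) *)

Section PermutationModule.
Variables (F : fieldType) (k f : nat).
Implicit Types (s t p q h : 'S_k) (x y : GA F k) (c : F) (i j : 'I_k) (js : seq nat).
Implicit Types (u v : seq bool).

Lemma tgen_tperm i j : j = i.+1 :> nat -> tgen k j = tperm i j.
Proof.
case: k i j => [[] // | k'] i j Eji.
rewrite /tgen Eji ltn0Sn -[X in (X < _)%N]Eji ltn_ord /=; congr tperm.
  exact: inord_val.
by rewrite -Eji inord_val.
Qed.

Lemma tgenK n : (tgen k n * tgen k n = 1)%g.
Proof. by rewrite /tgen; case: k => [|k']; [|case: ifP]; rewrite ?tperm2 ?mulg1. Qed.

(* As [(p * s) i = s (p i)], left multiplication permutes the positions of the letters. *)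
Definition perm_word s : k.-tuple bool := [tuple (f <= s i)%N | i < k].

Lemma nth_perm_word s i : nth false (perm_word s) i = (f <= s i)%N.
Proof. by rewrite -tnth_nth tnth_mktuple. Qed.

Lemma perm_word1 : (f <= k)%N ->
  perm_word 1%g = nseq f false ++ nseq (k - f) true :> seq bool.
Proof.
move=> le_fk; apply: (@eq_from_nth _ false) => [|n].
  by rewrite size_tuple size_cat !size_nseq subnKC.
rewrite size_tuple => lt_nk.
rewrite -[n]/(nat_of_ord (Ordinal lt_nk)) nth_perm_word perm1 /=.
rewrite nth_cat !nth_nseq size_nseq if_same; case: ltnP => // le_fn.
by rewrite ltn_sub2r ?(leq_ltn_trans le_fn).
Qed.

Lemma perm_word_tgen s u v a b : perm_word s = u ++ a :: b :: v :> seq bool ->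
  perm_word (tgen k (size u).+1 * s)%g = u ++ b :: a :: v :> seq bool.
Proof.
move=> Es; have := size_tuple (perm_word s); rewrite Es size_cat /= => szk.
have lt_ik : (size u < k)%N by lia.
have lt_jk : ((size u).+1 < k)%N by lia.
apply: (@eq_from_nth _ false) => [|n]; first by rewrite (size_tuple (perm_word _)) size_cat.
rewrite (size_tuple (perm_word _)) => lt_nk.
rewrite -[n]/(nat_of_ord (Ordinal lt_nk)) nth_perm_word permM -nth_perm_word Es.
rewrite (@tgen_tperm (Ordinal lt_ik) (Ordinal lt_jk)) //.
case: tpermP => [->|->|/eqP ne_i /eqP ne_j].
- by rewrite !nth_cat /= ltnn subnn ltnNge leqnSn subSnn.
- by rewrite !nth_cat /= ltnn subnn ltnNge leqnSn subSnn.
rewrite -!val_eqE /= in ne_i ne_j; rewrite !nth_cat /=; case: ltnP => // le_un.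
by case E: (n - size u)%N => [|[|m]] //; lia.
Qed.

Lemma perm_word_tgen_eq s u v a b :
  (perm_word (tgen k (size u).+1 * s)%g == u ++ a :: b :: v :> seq bool) =
  (perm_word s == u ++ b :: a :: v :> seq bool).
Proof.
apply/eqP/eqP => /perm_word_tgen //.
by rewrite mulgA tgenK mul1g.
Qed.

Lemma gamulBl x x' y : gamul (x - x') y = gamul x y - gamul x' y.
Proof.
by apply/ffunP => s; rewrite !ffunE -sumrB; apply: eq_bigr => p _; rewrite !ffunE mulrBl.
Qed.

Lemma gamulBr x y y' : gamul x (y - y') = gamul x y - gamul x y'.
Proof.
by apply/ffunP => s; rewrite !ffunE -sumrB; apply: eq_bigr => p _; rewrite !ffunE mulrBr.
Qed.

Lemma gamul0l y : gamul 0 y = 0.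
Proof. by rewrite -[0 in LHS](subrr y) gamulBl subrr. Qed.

Lemma gamulZl c x y : gamul (gascale c x) y = gascale c (gamul x y).
Proof.
apply/ffunP => s; rewrite !ffunE mulr_sumr; apply: eq_bigr => p _.
by rewrite ffunE mulrA.
Qed.

Lemma gamul_gdeltal p y s : gamul (gdelta F p) y s = y (p^-1 * s)%g.
Proof.
rewrite ffunE (bigD1 p) //= ffunE eqxx mul1r big1 ?addr0 // => t /negPf ts.
by rewrite ffunE ts mul0r.
Qed.

Lemma gamul_gdelta p q : gamul (gdelta F p) (gdelta F q) = gdelta F (p * q)%g.
Proof.
apply/ffunP => s; rewrite gamul_gdeltal !ffunE.
by rewrite (can2_eq (mulKVg p) (mulKg p)).
Qed.

(* The coefficient of the word v in x m, where m is the word 0^f 1^(k - f). *)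
Definition word_coef v x : F := \sum_s x s * (perm_word s == v :> seq bool)%:R.

Lemma word_coefB v x y : word_coef v (x - y) = word_coef v x - word_coef v y.
Proof. by rewrite /word_coef -sumrB; apply: eq_bigr => s _; rewrite !ffunE mulrBl. Qed.

Lemma word_coef_sum v (I : finType) (P : pred I) (y : I -> GA F k) :
  word_coef v (\sum_(i | P i) y i) = \sum_(i | P i) word_coef v (y i).
Proof.
rewrite /word_coef exchange_big /=; apply: eq_bigr => s _.
by rewrite sum_ffunE mulr_suml.
Qed.

Lemma word_coefZ v c x : word_coef v (gascale c x) = c * word_coef v x.
Proof. by rewrite /word_coef mulr_sumr; apply: eq_bigr => s _; rewrite ffunE mulrA. Qed.

Lemma word_coef_gdelta v s : word_coef v (gdelta F s) = (perm_word s == v :> seq bool)%:R.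
Proof.
rewrite /word_coef (bigD1 s) //= ffunE eqxx mul1r big1 ?addr0 // => t /negPf ts.
by rewrite ffunE ts mul0r.
Qed.

Lemma word_coef_gdeltaM v p y :
  word_coef v (gamul (gdelta F p) y) =
  \sum_s y s * (perm_word (p * s)%g == v :> seq bool)%:R.
Proof.
rewrite /word_coef (reindex_inj (mulgI p)) /=; apply: eq_bigr => s _.
by rewrite gamul_gdeltal mulKg.
Qed.

Lemma word_coef_sgenM u v a b y :
  word_coef (u ++ a :: b :: v) (gamul (sgen F k (size u).+1) y) =
  word_coef (u ++ b :: a :: v) y - word_coef (u ++ a :: b :: v) y.
Proof.
rewrite gamulBl word_coefB !word_coef_gdeltaM; congr (_ - _); apply: eq_bigr => s _.
  by rewrite perm_word_tgen_eq.
by rewrite mul1g.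
Qed.

Definition tgen_prod js s : 'S_k := foldr (fun n acc => tgen k n * acc)%g s js.

Definition sgen_prod js y : GA F k := foldr (fun n acc => gamul (sgen F k n) acc) y js.

Lemma perm_word_tgen_prod_iota s u n v :
  perm_word s = u ++ nseq n false ++ true :: v :> seq bool ->
  perm_word (tgen_prod (iota (size u).+1 n) s) = u ++ true :: nseq n false ++ v :> seq bool.
Proof.
elim: n u => [|n IHn] u //= Es.
have {}Es : perm_word s = rcons u false ++ nseq n false ++ true :: v :> seq bool.
  by rewrite cat_rcons.
by have := IHn _ Es; rewrite size_rcons cat_rcons => /perm_word_tgen.
Qed.

Lemma word_coef_sgen_prod_iota y u n v : size (u ++ nseq n false ++ true :: v) = k ->
    (forall z, size z = k ->
      word_coef z y = (cup_vec (u ++ nseq n false ++ true :: v) z)%:~R) ->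
  forall z, size z = k ->
    word_coef z (sgen_prod (iota (size u).+1 n) y) =
    (cup_vec (u ++ true :: nseq n false ++ v) z)%:~R.
Proof.
elim: n u => [|n IHn] u //= szk Ey z szz.
have [|z1 [a [b [z2 [Ez sz1 _]]]]] := @split_pair _ z (size u) (n + size v).
  by rewrite szz -szk !size_cat /= size_cat size_nseq /=; lia.
have szz' : size (z1 ++ b :: a :: z2) = k by rewrite -szz Ez !size_cat.
rewrite Ez -sz1 word_coef_sgenM sz1 -(size_rcons u false) !IHn -?Ez ?cat_rcons //.
by rewrite -rmorphB Ez /cup_vec cup_coef_swap.
Qed.

Lemma perm_word_lam_index l g : k = (f + (size l + g))%N -> path geq f l ->
  perm_word (tgen_prod (lam_index f (size l) l) 1%g) =
    word_of_part f l ++ nseq g true :> seq bool.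
Proof.
elim: l g => [|x l IHl] g Ek /=.
  by move=> _; rewrite perm_word1 Ek; [rewrite add0n addKn | lia].
case/andP=> le_xf path_l.
rewrite lam_index_cons /tgen_prod foldr_cat -(size_word_of_part path_l).
rewrite (@perm_word_tgen_prod_iota _ _ _ (nseq g true)) -?catA //.
rewrite (IHl g.+1) ?(path_le geq_trans le_xf) //; last by rewrite Ek /=; lia.
by rewrite (word_of_part_widen le_xf path_l) -catA.
Qed.

Lemma word_coef_lam_index l g : k = (f + (size l + g))%N -> path geq f l ->
  forall v, size v = k ->
  word_coef v (sgen_prod (lam_index f (size l) l) (gdelta F 1%g)) =
  (cup_vec (word_of_part f l ++ nseq g true) v)%:~R.
Proof.
elim: l g => [|x l IHl] g Ek /=.
  move=> _ v szv; rewrite word_coef_gdelta perm_word1 Ek; last by lia.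
  by rewrite add0n addKn cup_vec_nseq ?szv // eq_sym mulrz_nat.
case/andP=> le_xf path_l v szv.
rewrite lam_index_cons /sgen_prod foldr_cat -(size_word_of_part path_l).
rewrite (@word_coef_sgen_prod_iota _ _ _ (nseq g true)) ?[RHS]catA -?catA //.
  by rewrite !size_cat !size_nseq /= size_nseq size_word_of_part // Ek /=; lia.
move=> z szz; rewrite (IHl g.+1) ?(path_le geq_trans le_xf) //; last by rewrite Ek /=; lia.
by rewrite (word_of_part_widen le_xf path_l) -catA.
Qed.

(* M^(f,g) is the quotient of the group algebra by this left ideal, m being the class
   of 1, so that x m = y m means relation_ideal (x - y). *)
Definition relation_ideal x : Prop :=
  exists a : nat -> GA F k, x = \sum_(1 <= n < k | n != f) gamul (a n) (sgen F k n).

Lemma relation_ideal0 : relation_ideal 0.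
Proof. by exists (fun=> 0); rewrite big1 // => n _; rewrite gamul0l. Qed.

Lemma relation_idealB x y : relation_ideal x -> relation_ideal y -> relation_ideal (x - y).
Proof.
move=> [a ->] [b ->]; exists (fun n => a n - b n); rewrite -sumrB.
by apply: eq_bigr => n _; rewrite gamulBl.
Qed.

Lemma relation_idealD x y : relation_ideal x -> relation_ideal y -> relation_ideal (x + y).
Proof.
move=> Jx Jy; rewrite -[y]opprK -[- y]add0r; apply: relation_idealB => //.
exact: relation_idealB relation_ideal0 Jy.
Qed.

Lemma relation_idealZ c x : relation_ideal x -> relation_ideal (gascale c x).
Proof.
move=> [a ->]; exists (fun n => gascale c (a n)); apply/ffunP => s.
rewrite ffunE !sum_ffunE mulr_sumr; apply: eq_bigr => n _.
by rewrite gamulZl [RHS]ffunE.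
Qed.

Lemma relation_ideal_sgen x n : (0 < n < k)%N -> n != f ->
  relation_ideal (gamul x (sgen F k n)).
Proof.
move=> lt_nk ne_nf; exists (fun n' => if n' == n then x else 0).
rewrite big_mkcond (bigD1_seq n) ?iota_uniq ?mem_index_iota //= ne_nf eqxx.
by rewrite big1 ?addr0 // => n' /negPf->; rewrite gamul0l if_same.
Qed.

(* The permutations h with h m = m; multiplying by s gives s h m = s m. *)
Definition fixes_m h : Prop := forall s, relation_ideal (gdelta F (s * h)%g - gdelta F s).

Lemma fixes_m1 : fixes_m 1%g.
Proof. by move=> s; rewrite mulg1 subrr; apply: relation_ideal0. Qed.

Lemma fixes_mM h h' : fixes_m h -> fixes_m h' -> fixes_m (h * h')%g.
Proof.
move=> fix_h fix_h' s; rewrite mulgA -(subrKA (gdelta F (s * h)%g)).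
exact: relation_idealD.
Qed.

Lemma fixes_m_tgen n : (0 < n < k)%N -> n != f -> fixes_m (tgen k n).
Proof.
move=> lt_nk ne_nf s; rewrite -gamul_gdelta -{2}[s]mulg1 -gamul_gdelta -gamulBr.
exact: relation_ideal_sgen.
Qed.

Lemma fixes_m_tperm i j : (f <= i)%N = (f <= j)%N -> fixes_m (tperm i j).
Proof.
wlog le_ij : i j / (i <= j)%N => [fix_le | ].
  case: (leqP i j) => [/fix_le // | /ltnW/fix_le fix_ji same].
  by rewrite tpermC; apply: fix_ji.
have [n Ej] : exists n, j = (i + n)%N :> nat by exists (j - i)%N; rewrite subnKC.
elim: n j Ej {le_ij} => [|n IHn] j Ej same.
  have -> : i = j by apply: val_inj; rewrite /= Ej addn0.
  by rewrite tperm1; apply: fixes_m1.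
have lt_jk : (j.-1 < k)%N by rewrite (leq_ltn_trans (leq_pred j)).
pose j' := Ordinal lt_jk.
have fix_jj' : fixes_m (tperm j' j).
  rewrite -tgen_tperm /=; last by lia.
  by apply: fixes_m_tgen; have := ltn_ord j; lia.
have [-> // | ne_ij'] := eqVneq i j'.
have -> : tperm i j = (tperm j' j * tperm i j' * tperm j' j)%g.
  rewrite -{1}(tpermV j' j) -mulgA -conjgE tpermJ tpermL tpermD // eq_sym //.
  by rewrite -val_eqE /=; lia.
have fix_ij' : fixes_m (tperm i j') by apply: IHn => /=; lia.
exact: (fixes_mM (fixes_mM fix_jj' fix_ij') fix_jj').
Qed.

Lemma fixes_m_stab h : (forall j, (f <= h j)%N = (f <= j)%N) -> fixes_m h.
Proof.
suff fix_above n : (forall j, (n <= j)%N -> h j = j) ->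
    (forall j, (f <= h j)%N = (f <= j)%N) -> fixes_m h.
  by apply: (fix_above k) => j; rewrite leqNgt ltn_ord.
elim: n h => [|n IHn] h fix_n stab_h.
  have -> : h = 1%g by apply/permP => j; rewrite fix_n ?perm1.
  exact: fixes_m1.
have [le_kn | lt_nk] := leqP k n.
  by apply: IHn => // j le_nj; have := ltn_ord j; rewrite ltnNge (leq_trans le_kn).
pose i := Ordinal lt_nk.
rewrite -[h]mulg1 -(tperm2 (h i) i) mulgA.
apply: fixes_mM; last by apply: fixes_m_tperm; apply: stab_h.
apply: IHn => j.
  rewrite leq_eqVlt permM => /predU1P[Ej | lt_nj].
    by have -> : j = i; [apply: val_inj | rewrite tpermL].
  have ne_ij : i != j by rewrite -val_eqE /= ltn_eqF.
  rewrite (fix_n j) // tpermD //.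
  by rewrite -(fix_n j lt_nj) (inj_eq perm_inj).
rewrite permM; case: tpermP => [/perm_inj-> | Ehj | _ _] //.
by rewrite -[RHS]stab_h stab_h -stab_h Ehj.
Qed.

Lemma relation_ideal_perm_word s t : perm_word s = perm_word t ->
  relation_ideal (gdelta F s - gdelta F t).
Proof.
move=> Est; rewrite -[s](mulKVg t); apply: fixes_m_stab => j.
by rewrite permM -nth_perm_word Est nth_perm_word permKV.
Qed.

Lemma relation_ideal_word_coef x :
  (forall v : k.-tuple bool, word_coef v x = 0) -> relation_ideal x.
Proof.
move=> coef0; pose rep (v : k.-tuple bool) := odflt 1%g [pick s | perm_word s == v].
have perm_word_rep s : perm_word (rep (perm_word s)) = perm_word s.
  by rewrite /rep; case: pickP => [t /eqP // | /(_ s)]; rewrite eqxx.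
have -> : x = \sum_s gascale (x s) (gdelta F s - gdelta F (rep (perm_word s))).
  apply/ffunP => q; rewrite sum_ffunE.
  under eq_bigr do rewrite !ffunE mulrBr.
  rewrite sumrB (bigD1 q) //= eqxx mulr1 big1 ?addr0 => [|s /negPf]; last first.
    by rewrite eq_sym => ->; rewrite mulr0.
  rewrite (partition_big perm_word xpredT) //= big1 ?subr0 // => v _.
  transitivity (word_coef v x * (q == rep v)%:R); last by rewrite coef0 mul0r.
  rewrite mulr_suml big_mkcond; apply: eq_bigr => s _; rewrite val_eqE.
  by case: eqP => [-> | _]; rewrite ?mulr1 // mulr0 mul0r.
apply: big_ind => [||s _]; [exact: relation_ideal0 | exact: relation_idealD |].
by apply: relation_idealZ; apply: relation_ideal_perm_word; rewrite perm_word_rep.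
Qed.
End PermutationModule.

Section Partitions.
Variables (F : fieldType) (f g : nat).
Implicit Types (t : g.-tuple 'I_f.+1) (v : (f + g).-tuple bool).

Lemma word_coef_t_lam t v : is_part t ->
  word_coef f v (gdelta F (t_lam f g (map val t))) = (word_of_part f (map val t) == v)%:R.
Proof.
rewrite is_partE => path_t.
have sz_t : size (map val t) = g by rewrite size_map size_tuple.
have := @perm_word_lam_index (f + g) f (map val t) 0.
by rewrite word_coef_gdelta sz_t addn0 cats0 => ->.
Qed.

Lemma word_coef_s_lam t v : is_part t ->
  word_coef f v (s_lam F f g (map val t)) = (cup_vec (word_of_part f (map val t)) v)%:~R.
Proof.
rewrite is_partE => path_t.
have sz_t : size (map val t) = g by rewrite size_map size_tuple.
have := @word_coef_lam_index F (f + g) f (map val t) 0.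
by rewrite sz_t addn0 cats0 => ->; rewrite ?size_tuple.
Qed.

Lemma word_coef_Fpart_s_lam t v : is_part t ->
  word_coef f v (gascale (Fpart (map val t))%:R (s_lam F f g (map val t))) =
  ((Fword (word_of_part f (map val t)))%:Z * cup_vec (word_of_part f (map val t)) v)%:~R.
Proof.
move=> pt; rewrite word_coefZ word_coef_s_lam // rmorphM /=.
by rewrite /Fword word_of_partK -?is_partE.
Qed.
End Partitions.

Theorem theorem5p12 (F : fieldType) (f g : nat) :
  exists a : nat -> GA F (f + g),
    \sum_(t : g.-tuple 'I_f.+1 | is_part t) gdelta F (t_lam f g (map val t))
    - \sum_(t : g.-tuple 'I_f.+1 | is_part t)
        gascale (Fpart (map val t))%:R (s_lam F f g (map val t))
    = \sum_(1 <= i < f + g | i != f) gamul (a i) (sgen F (f + g) i).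
Proof.
apply: relation_ideal_word_coef => v.
rewrite word_coefB !word_coef_sum.
under eq_bigr => t pt do rewrite word_coef_t_lam //.
under [X in _ - X]eq_bigr => t pt do rewrite word_coef_Fpart_s_lam //.
rewrite (sum_word_of_part _ _ (fun w => (w == v)%:R)).
rewrite (sum_word_of_part _ _ (fun w => ((Fword w)%:Z * cup_vec w v)%:~R)).
rewrite sum_eq_word -[X in _ - X](rmorph_sum intr) sum_Fword_cup_vec_zeros.
by rewrite /= mulrz_nat subrr.
Qed.
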